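(* For every subset $A\subseteq\mathbb{R}$, the space $M_A$ is separable and contractible.
   Context: The Moore plane $M$ is the following topological space. As a set, $M$ is the disjoint union of the open upper half plane $\mathbb{R}^2_+=\{(x,y)\in\mathbb{R}^2: y>0\}$ and, for each $a\in\mathbb{R}$, a ray $R_a=\{(a,z): z\ge 0\}$ (the points of the rays are regarded as new points, distinct from the points of $\mathbb{R}^2_+$ and from the points of the other rays). Topology: $\mathbb{R}^2_+$ is open in $M$ and carries its usual topology; a point $(a,z)\in R_a$ has as basic open neighborhoods the sets, for $\varepsilon>0$, $$\{(a,w)\in R_a: w\ge 0,\ |w-z|<\varepsilon\}\ \cup\ \Big\{(x,y)\in\mathbb{R}^2_+: 0<y<\varepsilon,\ \Big|\tfrac{|x-a|}{y}-z\Big|<\varepsilon\Big\}.$$ Thus each $R_a$ is closed in $M$ with its usual topology, and a sequence $(x_n,y_n)$ in $\mathbb{R}^2_+$ converges to $(a,z)\in R_a$ if and only if $(x_n,y_n)\to(a,0)$ in $\mathbb{R}^2$ and $y_n/|x_n-a|\to 1/z$ (with $1/0=+\infty$, and $y_n/|x_n-a|=+\infty$ if $x_n=a$). For $A\subseteq\mathbb{R}$, $M_A=\mathbb{R}^2_+\cup\bigcup_{a\in A}R_a\subseteq M$ with the subspace topology; it is an open subset of $M$. Separable means having a countable dense subset. *)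

(* Defs.v *)
From HB Require Import structures.
From mathcomp Require Import all_boot all_order all_algebra.
From mathcomp Require Import all_classical all_reals all_analysis.

Set Implicit Arguments.
Unset Strict Implicit.
Unset Printing Implicit Defensive.

Import Order.TTheory GRing.Theory Num.Theory.
Import numFieldNormedType.Exports.

Local Open Scope classical_set_scope.
Local Open Scope ring_scope.

Definition separable (T : topologicalType) : Prop :=
  exists D : set T, countable D /\ dense D.

(* Only the values of the homotopy at times in [0, 1] matter. *)
Definition homotopic (R : realType) (X Y : topologicalType) (f g : X -> Y)
    : Prop :=
  exists H : X * R -> Y,
    [/\ {within [set: X] `*` `[0, 1], continuous H},
        forall x, H (x, 0) = f x &
        forall x, H (x, 1) = g x].

Definition contractible (R : realType) (T : topologicalType) : Prop :=
  exists c : T, homotopic R (@idfun T) (cst c).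

Definition half_plane (R : realType) : set (R * R) := [set p | 0 < p.2].
Arguments half_plane : clear implicits.

Definition half_line (R : realType) : set R := [set z | 0 <= z].
Arguments half_line : clear implicits.

(* [Half p] is the point p of the open upper half plane, [Ray a z] is the
   point (a, z) of the ray R_a. *)
Variant moore_plane (R : realType) : Type :=
| Half of half_plane R
| Ray of R & half_line R.

Section moore_topology.
Context {R : realType}.
Local Notation M := (moore_plane R).

HB.instance Definition _ := gen_eqMixin M.
HB.instance Definition _ := gen_choiceMixin M.

Definition ray_basic (a : R) (z : half_line R) (e : R) : set M :=
  (Ray a @` [set w : half_line R | `|\val w - \val z| < e]) `|`
  (@Half R @` [set p : half_plane R |
     0 < (\val p).2 < e /\
     `| `|(\val p).1 - a| / (\val p).2 - \val z| < e]).

Definition moore_nbhs (m : M) : set_system M :=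
  match m with
  | Half p => [set U | nbhs p (@Half R @^-1` U)]
  | Ray a z => [set U | exists2 e : R, 0 < e & ray_basic a z e `<=` U]
  end.

HB.instance Definition _ := hasNbhs.Build M moore_nbhs.

Lemma ray_basic_le a z (d e : R) : d <= e -> ray_basic a z d `<=` ray_basic a z e.
Proof.
move=> de m [[w /= wd <-]|[p /= [/andP[p0 pd] pz] <-]]; [left|right].
  by exists w => //=; exact: lt_le_trans de.
exists p => //=; split; last exact: lt_le_trans de.
by rewrite p0 (lt_le_trans pd).
Qed.

Let moore_nbhs_filter (m : M) : ProperFilter (nbhs m).
Proof.
change (ProperFilter (moore_nbhs m)).
case: m => [p|a z]; rewrite /moore_nbhs.
  exact: (@fmap_proper_filter _ _ (@Half R) (nbhs p)).
apply: Build_ProperFilter_ex.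
  move=> U [e e0 eU]; exists (Ray a z); apply: eU; left; exists z => //=.
  by rewrite subrr normr0.
split; first by exists 1.
  move=> U V [d d0 dU] [e e0 eV]; exists (Num.min d e).
    by rewrite lt_min d0 e0.
  move=> m h; split; [apply: dU|apply: eV]; apply: ray_basic_le h.
    by rewrite ge_min lexx.
  by rewrite ge_min lexx orbT.
by move=> U V UV [e e0 eU]; exists e => //; exact: subset_trans UV.
Qed.

Let moore_nbhs_singleton (m : M) (U : set M) : nbhs m U -> U m.
Proof.
change (moore_nbhs m U -> U m).
case: m => [p|a z]; rewrite /moore_nbhs /=; first exact: nbhs_singleton.
move=> [e e0]; apply; left; exists z => //=.
by rewrite subrr normr0.
Qed.

Let ray_basic_nbhs (a : R) (z : half_line R) (e : R) (m : M) :
  ray_basic a z e m -> nbhs m (ray_basic a z e).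
Proof.
change (ray_basic a z e m -> moore_nbhs m (ray_basic a z e)).
case=> [[w /= we <-]|[p /= [/andP[p0 pe] pz] <-]]; rewrite /moore_nbhs /=.
  exists (e - `|\val w - \val z|); first by rewrite subr_gt0.
  move=> n [[v /= ve <-]|[q /= [/andP[q0 qe] qw] <-]]; [left|right].
    exists v => //=; rewrite (le_lt_trans (ler_distD (\val w) _ _))//.
    by rewrite -ltrBrDr.
  exists q => //=; split.
    by rewrite q0 (lt_le_trans qe)// gerBl.
  rewrite (le_lt_trans (ler_distD (\val w) _ _))//.
  by rewrite -ltrBrDr.
have pN0 : (\val p).2 != 0 by rewrite gt_eqF.
have vc : {for p, continuous (fun q : half_plane R => \val q : R * R)}.
  exact: initial_continuous.
have c1 : (fun q : half_plane R => (\val q).1) @ p --> (\val p).1.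
  by apply: cvg_comp vc _; exact: cvg_fst.
have c2 : (fun q : half_plane R => (\val q).2) @ p --> (\val p).2.
  by apply: cvg_comp vc _; exact: cvg_snd.
have c3 : (fun q : half_plane R =>
    `| `|(\val q).1 - a| / (\val q).2 - \val z|) @ p -->
    `| `|(\val p).1 - a| / (\val p).2 - \val z|.
  apply: (@cvg_norm _ _ _ (nbhs p)).
  apply: (@cvgB _ _ _ (nbhs p)); last exact: cvg_cst.
  apply: (@cvgM _ _ (nbhs p)); last exact: (@cvgV _ _ (nbhs p)).
  apply: (@cvg_norm _ _ _ (nbhs p)).
  by apply: (@cvgB _ _ _ (nbhs p)) c1 _; exact: cvg_cst.
have n1 : \forall q \near p, (\val q).2 < e.
  by apply: (c2 [set r : R | r < e]); exact: lt_nbhsl.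
have n2 : \forall q \near p,
    `| `|(\val q).1 - a| / (\val q).2 - \val z| < e.
  by apply: (c3 [set r : R | r < e]); exact: lt_nbhsl.
apply: filterS2 n1 n2 => q q1 q2; right; exists q => //; split => //.
by rewrite q1 andbT; have := set_valP q.
Qed.

Let moore_nbhs_nbhs (m : M) (U : set M) : nbhs m U -> nbhs m (nbhs^~ U).
Proof.
change (moore_nbhs m U -> moore_nbhs m (moore_nbhs^~ U)).
case: m => [p|a z]; rewrite /moore_nbhs /=.
  exact: nbhs_interior.
move=> [e e0 eU]; exists e => // m /ray_basic_nbhs.
by apply: (@filterS _ (nbhs m)) eU; exact: moore_nbhs_filter.
Qed.

HB.instance Definition _ := Nbhs_isNbhsTopological.Build M
  moore_nbhs_filter moore_nbhs_singleton moore_nbhs_nbhs.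

Definition moore_sub (A : set R) : set M :=
  range (@Half R) `|` \bigcup_(a in A) range (Ray a).

Lemma open_ray_basic a z e : open (ray_basic a z e).
Proof. by rewrite openE => m; exact: ray_basic_nbhs. Qed.

Lemma open_moore_sub A : open (moore_sub A).
Proof.
rewrite openE => m [[p _ <-]|[a Aa [z _ <-]]].
  change (nbhs p (@Half R @^-1` moore_sub A)).
  by apply: filterE => q; left; exists q.
exists 1 => // n [[w _ <-]|[q _ <-]]; last by left; exists q.
by right; exists a => //; exists w.
Qed.

End moore_topology.

(* Main.v *)
Require Import Defs.
From mathcomp Require Import all_boot all_order all_algebra.
From mathcomp Require Import all_classical all_reals all_analysis.
From mathcomp Require Import ring lra.

Set Implicit Arguments.
Unset Strict Implicit.
Unset Printing Implicit Defensive.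

Import Order.TTheory GRing.Theory Num.Theory.
Import numFieldNormedType.Exports.

Local Open Scope classical_set_scope.
Local Open Scope ring_scope.

(** The contraction is a single explicit map [flow] on the whole Moore plane,
running in two stages and preserving every [moore_sub A].

Lifting points straight up at once does not work: a point (x, y) near (a, z)
with z > 0 is characterised by the slope |x - a| / y being close to z, and
adding a small s to y changes this slope abruptly when y is much smaller than
s.  Only the bases (a, 0) of the rays can be lifted continuously.  So in the
first stage, with tau running from 0 to 1, each ray is shrunk to its base by
(a, z) |-> (a, (1 - tau) z), and the half plane is stretched vertically by
y |-> y / ((1 - tau) + tau * sqrt y).  Near the boundary the stretching
multiplies the slope by about 1 - tau, so the two rules fit together, also at
tau = 1, where y |-> sqrt y makes all the slopes tend to 0.

The second stage, with s running from 0 to 1, starts from the map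
(x, y) |-> (x, sqrt y), (a, z) |-> (a, 0), and moves its image by
(x, h) |-> ((1 - s^2) x, (1 - s^2) h + s), where the base (a, 0) counts as a
point of height h = 0; it ends at (0, 1).  Horizontal motion of order s^2 is
negligible against vertical motion s, so near a base (a, 0) the slope seen from
a stays small ([drift_slope]).

Continuity has two cases.  Where the image lies in the half plane, [flow] is
[drift], a continuous function of the time and of [shadow], the projection of
the Moore plane onto the closed half plane.  Where the image lies on a ray, the
neighbourhoods of the image are tested by height and slope, which
[ray_basic_flow] controls by functions that are continuous at that point.

For separability, every neighbourhood of every point meets the open half
plane, hence contains a point with rational coordinates. *)

(** * Limits in subspaces and products *)

Lemma cvg_set_val (T : topologicalType) (A : set T) (X : Type)
    (F : set_system X) {FF : Filter F} (f : X -> A) (y : A) :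
  (fun x => set_val (f x)) @ F --> set_val y -> f @ F --> y.
Proof.
move=> fy U [_ [[C oC <-] Cy CU]].
have /fy FC : nbhs (set_val y) C by apply: open_nbhs_nbhs.
by apply: (@filterS _ F) FC => x; exact: CU.
Qed.

Lemma cvg_fst_nbhs (X Y : topologicalType) (x : X) (y : Y) :
  i.1 @[i --> (x, y)] --> x.
Proof. exact: cvg_fst. Qed.

Lemma cvg_snd_nbhs (X Y : topologicalType) (x : X) (y : Y) :
  i.2 @[i --> (x, y)] --> y.
Proof. exact: cvg_snd. Qed.

Section moore.
Context {R : realType}.
Local Notation M := (moore_plane R).
Implicit Types (m : M) (a e s t tau w x y : R) (p q : R * R).

(** * Points of the Moore plane from coordinates *)

Definition in_half_plane p : half_plane R :=
  insubd (exist _ (0, 1) (mem_set ltr01) : half_plane R) p.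

Definition half p : M := Half (in_half_plane p).

Definition line z : half_line R :=
  insubd (exist _ 0 (mem_set (lexx 0)) : half_line R) z.

Lemma moore_sub_half (A : set R) p : moore_sub A (half p).
Proof. by left; exists (in_half_plane p). Qed.

Lemma val_half p : 0 < p.2 -> \val (in_half_plane p) = p.
Proof. by move=> p0; rewrite insubdK//; exact: mem_set. Qed.

Lemma halfK (p : half_plane R) : half (\val p) = Half p.
Proof. by rewrite /half /in_half_plane valKd. Qed.

Lemma val_line z : 0 <= z -> \val (line z) = z.
Proof. by move=> z0; rewrite insubdK//; exact: mem_set. Qed.

Lemma lineK (z : half_line R) : line (\val z) = z.
Proof. by rewrite /line valKd. Qed.

(** Since [half_plane] is open, positivity of the heights holds eventually, so
the default value of [in_half_plane] is never met along the filter. *)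
Lemma cvg_half (T : Type) (F : set_system T) {FF : Filter F}
    (f : T -> R * R) p :
  0 < p.2 -> f @ F --> p -> half \o f @ F --> half p.
Proof.
move=> p0 fp U.
change (nbhs (in_half_plane p) (@Half R @^-1` U) -> (half \o f @ F) U) => Up.
suff /(_ _ Up) : in_half_plane \o f @ F --> in_half_plane p by [].
apply: cvg_set_val; rewrite [X in _ --> X]val_half //.
apply: cvg_trans (fp); apply: near_eq_cvg.
have : \forall i \near F, 0 < (f i).2.
  have : (fun i => (f i).2) @ F --> p.2 by apply: cvg_comp fp _; exact: cvg_snd.
  by move=> /(_ [set r | 0 < r]); apply; exact: lt_nbhsr.
by apply: filterS => i i0; rewrite /= [RHS]val_half.
Qed.

(** * Shadow and slope *)

(** The projection onto the closed half plane that collapses each ray to its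
base point on the axis. *)
Definition shadow m : R * R :=
  match m with Half p => \val p | Ray a _ => (a, 0) end.

(** The quantity that the topology compares with z near (a, z), extended to the
ray R_a by continuity. *)
Definition slope a m : R :=
  match m with Half p => `|(\val p).1 - a| / (\val p).2 | Ray _ z => \val z end.

Lemma shadow_ge0 m : 0 <= (shadow m).2.
Proof. by case: m => [p|a z] /=; [exact: ltW (set_valP p)|exact: lexx]. Qed.

Lemma near_ray a (z : half_line R) e : 0 < e ->
  \forall m \near Ray a z, ray_basic a z e m.
Proof. by move=> e0; exists e. Qed.

Lemma slope_shadow a z e m : ray_basic a z e m ->
  `|(shadow m).1 - a| = slope a m * (shadow m).2.
Proof.
case=> [[w _ <-]|[p _ <-]] /=; first by rewrite subrr normr0 mulr0.
by rewrite divfK// gt_eqF//; exact: (set_valP p).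
Qed.

Lemma slope_ge0 a m : 0 <= slope a m.
Proof.
case: m => [p|b z] /=; last exact: (set_valP z).
by rewrite divr_ge0// ltW//; exact: (set_valP p).
Qed.

Lemma cvg_slope a (z : half_line R) :
  slope a m @[m --> Ray a z] --> \val z.
Proof.
apply/(@cvgrPdist_lt _ _ _ (nbhs (Ray a z))) => e e0; exists e => //.
by move=> m [[w we <-]|[p [_ pe] <-]] /=; rewrite distrC.
Qed.

(** The height is small by definition of [ray_basic], and the horizontal
distance to [a] is height times slope, a product tending to [0 * z]. *)
Lemma cvg_shadow (F : set_system M) {FF : Filter F} a (z : half_line R) :
  F --> Ray a z -> shadow @ F --> ((a, 0) : R * R).
Proof.
move=> Faz.
have nearF e : 0 < e -> F (ray_basic a z e).
  by move=> e0; apply: Faz; exact: near_ray.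
have slopeF : slope a @ F --> \val z by move=> U /cvg_slope /Faz.
have c2 : (fun m => (shadow m).2) @ F --> (0:R).
  apply/cvgrPdist_lt => e e0; apply: filterS (nearF _ e0).
  move=> m [[w we <-]|[p [/andP[p0 pe] _] <-]] /=.
    by rewrite subrr normr0.
  by rewrite sub0r normrN gtr0_norm.
have c1 : (fun m => (shadow m).1) @ F --> a.
  apply/cvgrPdist_lt => e e0.
  have : (fun m => slope a m * (shadow m).2) @ F --> \val z * 0.
    exact: cvgM slopeF c2.
  rewrite mulr0 => /cvgr0Pnorm_lt /(_ _ e0) h.
  apply: filterS2 h (nearF _ ltr01) => m h /slope_shadow.
  rewrite distrC => ->.
  by rewrite ger0_norm ?mulr_ge0 ?slope_ge0 ?shadow_ge0// in h.
have : (fun m => ((shadow m).1, (shadow m).2)) @ F --> ((a, 0) : R * R).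
  exact: cvg_pair c1 c2.
suff -> : (fun m => ((shadow m).1, (shadow m).2)) = shadow by [].
by apply/funext => m; case: (shadow m).
Qed.

Lemma shadow_continuous : continuous shadow.
Proof.
case=> [p|a z]; last exact: (@cvg_shadow _ (nbhs_filter (Ray a z : M)) a z).
change ((fun q : half_plane R => \val q : R * R) @ p --> \val p).
exact: initial_continuous.
Qed.

(** * Vertical stretching of the half plane *)

(** The factor by which [stretch] divides heights, hence multiplies slopes: it
tends to [1 - tau] at the boundary. *)
Definition speed tau y := (1 - tau) + tau * Num.sqrt y.

Definition stretch tau y := y / speed tau y.

Lemma speed_gt0 tau y : 0 <= tau <= 1 -> 0 < y -> 0 < speed tau y.
Proof.
move=> /andP[t0 t1] y0; have : 0 < Num.sqrt y by rewrite sqrtr_gt0.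
rewrite /speed => ?; nra.
Qed.

Lemma stretch_gt0 tau y : 0 <= tau <= 1 -> 0 < y -> 0 < stretch tau y.
Proof. by move=> t01 y0; rewrite divr_gt0// speed_gt0. Qed.

Lemma stretch0 tau : stretch tau 0 = 0.
Proof. by rewrite /stretch mul0r. Qed.

(** The bound forces [stretch] to be continuous at height 0 uniformly in [tau],
although [speed] vanishes there for [tau = 1]. *)
Lemma stretch_bound tau y : 0 <= tau <= 1 -> 0 <= y ->
  0 <= stretch tau y <= y + Num.sqrt y.
Proof.
move=> t01; rewrite le_eqVlt => /predU1P[<-|y0].
  by rewrite stretch0 sqrtr0 addr0 lexx.
rewrite (ltW (stretch_gt0 t01 y0))/= ler_pdivrMr ?speed_gt0//.
have r0 : 0 < Num.sqrt y by rewrite sqrtr_gt0.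
have ry : Num.sqrt y * Num.sqrt y = y by rewrite -expr2 sqr_sqrtr// ltW.
rewrite /speed; move: t01 r0 ry; set r := Num.sqrt y => /andP[t0 t1] r0 <-.
have -> : (r * r + r) * (1 - tau + tau * r) =
  r * r + (1 - tau) * r + tau * (r * (r * r)) by ring.
have : 0 <= tau * (r * (r * r)) by rewrite !mulr_ge0// ltW.
have : 0 <= (1 - tau) * r by rewrite mulr_ge0 ?subr_ge0// ltW.
lra.
Qed.

Lemma cvg_stretch (T : Type) (F : set_system T) {FF : Filter F}
    (f g : T -> R) tau y :
  (forall i, 0 <= f i <= 1) -> (forall i, 0 <= g i) ->
  0 <= tau <= 1 -> 0 <= y ->
  f @ F --> tau -> g @ F --> y ->
  stretch (f i) (g i) @[i --> F] --> stretch tau y.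
Proof.
move=> f01 g0 t01 y0 ft gy.
have sy : Num.sqrt (g i) @[i --> F] --> Num.sqrt y.
  by apply: cvg_comp gy _; exact: sqrt_continuous.
move: y0; rewrite le_eqVlt => /predU1P[y0|y0].
  rewrite -y0 stretch0; rewrite -y0 in gy sy.
  apply: (@squeeze_cvgr _ _ _ _ (cst 0) (fun i => g i + Num.sqrt (g i))).
  - by apply: filterE => i; exact: stretch_bound.
  - exact: cvg_cst.
  - by have := cvgD gy sy; rewrite sqrtr0 addr0; apply.
apply: cvgM gy _; apply: cvgV; first by rewrite gt_eqF// speed_gt0.
apply: cvgD; last exact: cvgM.
by apply: cvgB ft; exact: cvg_cst.
Qed.

(** * The two clocks *)

Definition clamp t : R := Num.max 0 (Num.min 1 t).

Lemma clamp01 t : 0 <= clamp t <= 1.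
Proof. by rewrite le_max lexx/= ge_max ler01 ge_min lexx. Qed.

Lemma clamp_le0 t : t <= 0 -> clamp t = 0.
Proof.
move=> t0; rewrite /clamp min_r ?max_l//.
by rewrite (le_trans t0).
Qed.

Lemma clamp_ge1 t : 1 <= t -> clamp t = 1.
Proof. by move=> t1; rewrite /clamp min_l// max_r. Qed.

Lemma clamp_gt0 t : 0 < clamp t -> 0 < t.
Proof. by rewrite lt_max ltxx/= lt_min => /andP[]. Qed.

Lemma clamp_continuous : continuous clamp.
Proof.
move=> t; apply: (@continuous_max R R (cst 0) (Num.min 1)).
  exact: cvg_cst.
apply: (@continuous_min R R (cst 1) id) => //.
exact: cvg_cst.
Qed.

Definition shrink_time t := clamp (2 * t).

Definition lift_time t := clamp (2 * t - 1).

Lemma shrink_time_continuous : continuous shrink_time.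
Proof.
move=> t; have h : 2 * u @[u --> t] --> 2 * t by exact: mulrl_continuous.
by apply: cvg_comp h _; exact: clamp_continuous.
Qed.

Lemma lift_time_continuous : continuous lift_time.
Proof.
move=> t; have h : 2 * u - 1 @[u --> t] --> 2 * t - 1.
  by apply: cvgB; [exact: mulrl_continuous|exact: cvg_cst].
by apply: cvg_comp h _; exact: clamp_continuous.
Qed.

(** * The contraction *)

Definition drift s tau p : R * R :=
  ((1 - s ^+ 2) * p.1, (1 - s ^+ 2) * stretch tau p.2 + s).

Lemma drift_continuous (T : Type) (F : set_system T) {FF : Filter F}
    (f g : T -> R) (h : T -> R * R) s tau p :
  (forall i, 0 <= g i <= 1) -> (forall i, 0 <= (h i).2) ->
  0 <= tau <= 1 -> 0 <= p.2 ->
  f @ F --> s -> g @ F --> tau -> h @ F --> p ->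
  drift (f i) (g i) (h i) @[i --> F] --> drift s tau p.
Proof.
move=> g01 h0 t01 p0 fs gt hp.
have h1 : (h i).1 @[i --> F] --> p.1 by apply: cvg_comp hp _; exact: cvg_fst.
have h2 : (h i).2 @[i --> F] --> p.2 by apply: cvg_comp hp _; exact: cvg_snd.
have cs : 1 - f i ^+ 2 @[i --> F] --> 1 - s ^+ 2.
  by apply: cvgB; [exact: cvg_cst|exact: cvgM].
have d1 : (drift (f i) (g i) (h i)).1 @[i --> F] --> (drift s tau p).1.
  exact: cvgM cs h1.
have d2 : (drift (f i) (g i) (h i)).2 @[i --> F] --> (drift s tau p).2.
  by apply: cvgD fs; apply: cvgM cs _; exact: cvg_stretch.
exact: cvg_pair d1 d2.
Qed.

Definition scale_ray c m : M :=
  match m with Half _ => m | Ray a z => Ray a (line (c * \val z)) end.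

(** The image is on a ray exactly when the drifted shadow has height 0, that is
for the points of the rays as long as [lift_time] is 0. *)
Definition flow (mt : M * R) : M :=
  let s := lift_time mt.2 in let tau := shrink_time mt.2 in
  let p := drift s tau (shadow mt.1) in
  if 0 < p.2 then half p else scale_ray (1 - tau) mt.1.

Lemma flow0 m : flow (m, 0) = m.
Proof.
rewrite /flow /lift_time /shrink_time mulr0 sub0r !clamp_le0 ?lerN10//=.
rewrite /drift expr0n/= subr0 !mul1r addr0.
have str1 y : stretch 0 y = y.
  by rewrite /stretch /speed subr0 mul0r addr0 divr1.
rewrite str1; case: m => [p|a z] /=.
  by rewrite -surjective_pairing (set_valP p : 0 < (\val p).2) halfK.
by rewrite ltxx mul1r lineK.
Qed.

Lemma flow1 m : flow (m, 1) = half (0, 1).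
Proof.
rewrite /flow /lift_time /shrink_time mulr1 !clamp_ge1//; last 2 first.
- by lra.
- by lra.
by rewrite /drift expr1n subrr !mul0r add0r ltr01.
Qed.

Lemma flow_moore_sub A m t : moore_sub A m -> moore_sub A (flow (m, t)).
Proof.
rewrite /flow; case: ifP => _ mA; first exact: moore_sub_half.
case: mA => [[p _ <-]|[a Aa [z _ <-]]] /=; first by left; exists p.
by right; exists a => //; eexists.
Qed.

(** * Continuity of the contraction *)

Lemma flow_continuous_half m t :
  0 < (drift (lift_time t) (shrink_time t) (shadow m)).2 ->
  {for (m, t), continuous flow}.
Proof.
move=> p0.
pose D (mt : M * R) :=
  drift (lift_time mt.2) (shrink_time mt.2) (shadow mt.1).
have FF : Filter (nbhs (m, t)) by exact: nbhs_filter.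
have c1 : (i.1 : M) @[i --> (m, t)] --> m by exact: cvg_fst_nbhs.
have c2 : (i.2 : R) @[i --> (m, t)] --> t by exact: cvg_snd_nbhs.
have cD : D @ nbhs (m, t) --> D (m, t).
  apply: drift_continuous.
  - by move=> i; exact: clamp01.
  - by move=> i; exact: shadow_ge0.
  - exact: clamp01.
  - exact: shadow_ge0.
  - by apply: cvg_comp c2 _; exact: lift_time_continuous.
  - by apply: cvg_comp c2 _; exact: shrink_time_continuous.
  - by apply: cvg_comp c1 _; exact: shadow_continuous.
have fE : flow (m, t) = half (D (m, t)) by rewrite /flow p0.
change (flow @ nbhs (m, t) --> flow (m, t)); rewrite fE.
apply: cvg_trans (@cvg_half _ _ _ _ (D (m, t)) p0 cD).
apply: near_eq_cvg.
have D2 : (fun i => (D i).2) @ nbhs (m, t) --> (D (m, t)).2.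
  by apply: cvg_comp cD _; exact: cvg_snd.
have : \forall i \near (m, t), 0 < (D i).2.
  by apply: (D2 [set r | 0 < r]); exact: lt_nbhsr.
by apply: filterS => i i0; rewrite /flow i0.
Qed.

Lemma slope_stretch a z e m tau : 0 <= tau <= 1 -> ray_basic a z e m ->
  `|(shadow m).1 - a| =
    slope a m * speed tau (shadow m).2 * stretch tau (shadow m).2.
Proof.
move=> t01 am; rewrite (slope_shadow am).
have := shadow_ge0 m; rewrite le_eqVlt => /predU1P[<-|y0].
  by rewrite stretch0 !mulr0.
by rewrite -mulrA [speed _ _ * _]mulrC /stretch divfK// gt_eqF// speed_gt0.
Qed.

(** Here [k] is the slope after stretching.  Scaling toward the origin by
[1 - s^2] keeps the slope at most [k], up to a horizontal error [s^2 * |a|];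
the height being at least [s], the error contributes at most [s * |a|]. *)
Lemma drift_slope s tau p a k : 0 <= s <= 1 -> 0 <= k -> 0 <= stretch tau p.2 ->
  `|p.1 - a| = k * stretch tau p.2 ->
  `|(drift s tau p).1 - a| <= (k + s * `|a|) * (drift s tau p).2.
Proof.
move=> /andP[s0 s1] k0; rewrite /drift /=.
move: (stretch _ _) => g g0 pk.
have c0 : 0 <= 1 - s ^+ 2 by rewrite subr_ge0 expr_le1.
have -> : (1 - s ^+ 2) * p.1 - a =
  (1 - s ^+ 2) * (p.1 - a) - s ^+ 2 * a by ring.
apply: le_trans (ler_normB _ _) _.
rewrite (normrM (1 - _)) (normrM (s ^+ 2)) pk (ger0_norm c0).
rewrite (ger0_norm (sqr_ge0 s)).
have -> : (k + s * `|a|) * ((1 - s ^+ 2) * g + s) =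
  (1 - s ^+ 2) * (k * g) + s ^+ 2 * `|a| +
  (s * k + s * `|a| * ((1 - s ^+ 2) * g)) by ring.
by rewrite lerDl addr_ge0 ?mulr_ge0.
Qed.

(** The hypotheses are inequalities between functions of [(m, t)] that are
continuous at the points of the ray, so they hold near such a point.  Lifting
takes place only after the rays are shrunk, hence the last one. *)
Lemma ray_basic_flow a z d (w : half_line R) e m t :
  ray_basic a z d m ->
  `|slope a m * speed (shrink_time t) (shadow m).2 - \val w|
     + lift_time t * `|a| < e ->
  (shadow m).2 + Num.sqrt (shadow m).2 + lift_time t < e ->
  (0 < lift_time t -> \val w = 0) ->
  ray_basic a w e (flow (m, t)).
Proof.
move=> am ke ye sw; rewrite /flow /=.
have t01 : 0 <= shrink_time t <= 1 by exact: clamp01.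
have s01 : 0 <= lift_time t <= 1 by exact: clamp01.
move: (lift_time t) (shrink_time t) s01 t01 ke ye sw => s tau s01 t01 ke ye sw.
have /andP[s0 s1] := s01.
have [g0 gy] := andP (stretch_bound t01 (shadow_ge0 m)).
have k0 : 0 <= slope a m * speed tau (shadow m).2.
  rewrite mulr_ge0 ?slope_ge0// /speed addr_ge0// ?mulr_ge0 ?sqrtr_ge0//.
    by rewrite subr_ge0; case/andP: t01.
  by case/andP: t01.
have pk := slope_stretch t01 am.
have c0 : 0 <= 1 - s ^+ 2 by rewrite subr_ge0 expr_le1.
case: ifPn => [p0|].
  (* Image in the half plane: for [s = 0] the slope is exact, for [s > 0] it is
     only bounded above, which suffices as the target is the base. *)
  right; exists (in_half_plane (drift s tau (shadow m))) => //.
  rewrite /= val_half// p0/=; split.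
    apply: le_lt_trans ye; rewrite lerD2r; apply: le_trans gy.
    by rewrite ler_piMl// gerBl sqr_ge0.
  move: s0; rewrite le_eqVlt => /predU1P[s_eq0|s0].
    move: ke p0; rewrite -s_eq0 /drift /= expr0n/= subr0 !mul1r addr0 mul0r.
    rewrite addr0 => ke p0.
    by rewrite pk mulfK// gt_eqF.
  move: ke; rewrite sw// subr0 (ger0_norm k0) => ke.
  rewrite (sw s0 : sval w = 0) subr0.
  rewrite ger0_norm; last by apply: divr_ge0 => //; exact: ltW.
  apply: le_lt_trans ke.
  by rewrite ler_pdivrMr//; exact: drift_slope.
rewrite -leNgt /drift /= => p0.
have sE : s = 0.
  apply/eqP; rewrite eq_le s0 andbT; apply: le_trans p0.
  by rewrite lerDr mulr_ge0.
case: am pk k0 ke ye g0 gy p0 => [[v vz <-]|[p pz <-]] /= pk k0 ke ye g0 gy p0.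
  left; exists (line ((1 - tau) * \val v)) => //=.
  rewrite val_line; last first.
    rewrite mulr_ge0 ?(set_valP v : 0 <= \val v)// subr_ge0.
    by case/andP: t01.
  move: ke; rewrite /speed sqrtr0 mulr0 addr0 sE mul0r addr0.
  by rewrite [\val v * _]mulrC.
exfalso; move: p0; apply/negP; rewrite -ltNge sE expr0n/= subr0 mul1r addr0.
by apply: stretch_gt0 => //; exact: (set_valP p).
Qed.

Lemma flow_continuous_ray a (z : half_line R) t :
  lift_time t = 0 -> {for (Ray a z, t), continuous flow}.
Proof.
move=> s0.
have FF : Filter (nbhs (Ray a z, t)) by exact: nbhs_filter.
have w0 : 0 <= (1 - shrink_time t) * \val z.
  rewrite mulr_ge0 ?(set_valP z : 0 <= \val z)// subr_ge0.
  by case/andP: (clamp01 (2 * t)).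
have /val_line := w0; set w := line _ => wE.
have fE : flow (Ray a z, t) = Ray a w.
  by rewrite /flow /= s0 stretch0 mulr0 addr0 ltxx.
change (flow @ nbhs (Ray a z, t) --> flow (Ray a z, t)); rewrite fE.
move=> U [e e0 eU].
have c1 : (i.1 : M) @[i --> (Ray a z, t)] --> Ray a z by exact: cvg_fst_nbhs.
have c2 : (i.2 : R) @[i --> (Ray a z, t)] --> t by exact: cvg_snd_nbhs.
have cs : lift_time i.2 @[i --> (Ray a z, t)] --> (0 : R).
  by rewrite -s0; apply: cvg_comp c2 _; exact: lift_time_continuous.
have ct : shrink_time i.2 @[i --> (Ray a z, t)] --> shrink_time t.
  by apply: cvg_comp c2 _; exact: shrink_time_continuous.
have cy : (shadow i.1).2 @[i --> (Ray a z, t)] --> (0 : R).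
  have : shadow i.1 @[i --> (Ray a z, t)] --> ((a, 0) : R * R).
    by apply: cvg_comp c1 _; exact: (@shadow_continuous (Ray a z)).
  by move=> h; apply: cvg_comp h _; exact: cvg_snd.
have cry : Num.sqrt (shadow i.1).2 @[i --> (Ray a z, t)] --> (0 : R).
  rewrite -[X in _ --> X]sqrtr0.
  by apply: cvg_comp cy _; exact: sqrt_continuous.
have ck : `|slope a i.1 * speed (shrink_time i.2) (shadow i.1).2 - \val w|
    + lift_time i.2 * `|a| @[i --> (Ray a z, t)] --> (0 : R).
  have -> : 0 = `|\val z * ((1 - shrink_time t) + shrink_time t * 0) - \val w|
      + 0 * `|a|.
    by rewrite wE mulr0 addr0 mulrC subrr normr0 mul0r addr0.
  apply: cvgD; last by apply: cvgM => //; exact: cvg_cst.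
  apply: cvg_norm; apply: cvgB; last exact: cvg_cst.
  apply: cvgM; first by apply: cvg_comp c1 _; exact: cvg_slope.
  apply: cvgD; last exact: cvgM.
  by apply: cvgB => //; exact: cvg_cst.
have cye : (shadow i.1).2 + Num.sqrt (shadow i.1).2 + lift_time i.2
    @[i --> (Ray a z, t)] --> (0 : R).
  have : (shadow i.1).2 + Num.sqrt (shadow i.1).2 + lift_time i.2
    @[i --> (Ray a z, t)] --> (0 + 0 + 0 : R) by exact: cvgD (cvgD cy cry) cs.
  by rewrite !addr0.
have n1 := ck [set r | r < e] (lt_nbhsl e0).
have n2 := cye [set r | r < e] (lt_nbhsl e0).
have n3 : \forall i \near (Ray a z, t), ray_basic a z 1 i.1.
  by apply: c1; exact: near_ray.
(* If shrinking is unfinished at time [t], lifting has not begun near [t]. *)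
have n4 : \forall i \near (Ray a z, t), 0 < lift_time i.2 -> \val w = 0.
  have [t1|t1] := ltP (2 * t) 1.
    have : \forall i \near (Ray a z, t), i.2 < 1 / 2.
      by apply: (c2 [set r | r < 1 / 2]); apply: lt_nbhsl; lra.
    by apply: filterS => i i2 /clamp_gt0; lra.
  apply: filterE => i _; rewrite wE /shrink_time clamp_ge1//.
  by rewrite subrr mul0r.
change (\forall i \near (Ray a z, t), U (flow i)).
near=> i; apply: eU.
suff : ray_basic a w e (flow (i.1, i.2)) by rewrite -surjective_pairing.
by apply: (@ray_basic_flow a z 1); near: i.
Unshelve. all: end_near. Qed.

Lemma flow_continuous : continuous flow.
Proof.
case=> m t; have [p0|p0] :=
  ltP 0 (drift (lift_time t) (shrink_time t) (shadow m)).2.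
  exact: flow_continuous_half.
have /andP[s0 s1] : 0 <= lift_time t <= 1 by exact: clamp01.
have c0 : 0 <= 1 - lift_time t ^+ 2 by rewrite subr_ge0 expr_le1.
have t01 : 0 <= shrink_time t <= 1 by exact: clamp01.
have [g0 _] := andP (stretch_bound t01 (shadow_ge0 m)).
have sE : lift_time t = 0.
  apply/eqP; rewrite eq_le s0 andbT; apply: le_trans p0.
  by rewrite lerDr mulr_ge0.
case: m p0 g0 => [p|a z] p0 g0; last exact: flow_continuous_ray.
exfalso; move: p0; apply/negP; rewrite -ltNge /drift /= sE expr0n/= subr0.
by rewrite mul1r addr0; apply: stretch_gt0 => //; exact: (set_valP p).
Qed.

(** * Contractibility and separability *)

Definition half_in (A : set R) p : moore_sub A :=
  exist _ (half p) (mem_set (moore_sub_half A p)).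

Lemma contractible_moore_sub (A : set R) : contractible R (moore_sub A).
Proof.
exists (half_in A (0, 1)).
exists (fun xt => exist _ (flow (set_val xt.1, xt.2))
  (mem_set (flow_moore_sub xt.2 (set_valP xt.1)))).
split; last 2 first.
- by move=> x; apply: val_inj; rewrite /= flow0.
- by move=> x; apply: val_inj; rewrite /= flow1.
apply: continuous_subspaceT => -[x t].
apply: cvg_set_val => /=.
pose g (xt : moore_sub A * R) : M * R := (set_val xt.1, xt.2).
have cg : g @ nbhs (x, t) --> ((set_val x, t) : M * R).
  have c1 : (i.1 : moore_sub A) @[i --> (x, t)] --> x by exact: cvg_fst_nbhs.
  have d1 : set_val i.1 @[i --> (x, t)] --> (set_val x : M).
    by apply: cvg_comp c1 _; exact: initial_continuous.
  have d2 : (i.2 : R) @[i --> (x, t)] --> t by exact: cvg_snd_nbhs.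
  exact: cvg_pair d1 d2.
by apply: cvg_comp cg _; exact: flow_continuous.
Qed.

Lemma nbhs_rat x (U : set R) : nbhs x U -> exists q : rat, U (ratr q).
Proof.
move=> Ux; have U0 : U° !=set0 by exists x.
have [y [Uy [q _ qy]]] := dense_rat U0 (@open_interior _ U).
by exists q; rewrite qy; exact: interior_subset.
Qed.

Lemma nbhs_half_rat p (U : set M) : 0 < p.2 -> nbhs (half p) U ->
  exists q : rat * rat, U (half (ratr q.1, ratr q.2)).
Proof.
move=> p0 [_ [[B oB <-] Bp BU]].
have {}Bp : B p by rewrite -(val_half p0).
have : nbhs p B by apply: open_nbhs_nbhs.
move=> [[X Y] /= [Xp Yp] XY].
have [q1 Xq] := nbhs_rat Xp.
(* The second coordinate is also kept positive, to stay in the half plane. *)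
have [q2 [Yq q0]] := nbhs_rat (filterI Yp (lt_nbhsr p0)).
have : B (ratr q1, ratr q2) by exact: XY.
by rewrite -(@val_half (_, _) q0) => Bq; exists (q1, q2); exact: BU.
Qed.

(** A neighbourhood of (a, z) contains the points of the half plane of small
height and slope exactly z, and [nbhs_half_rat] applies to any of them. *)
Lemma nbhs_moore_rat m (U : set M) : nbhs m U ->
  exists q : rat * rat, U (half (ratr q.1, ratr q.2)).
Proof.
case: m => [p|a z].
  by rewrite -halfK; apply: nbhs_half_rat; exact: (set_valP p).
move=> [e e0 eU]; pose y := e / 2.
have y0 : 0 < y by rewrite divr_gt0.
have ye : y < e by rewrite /y; lra.
have z0 : 0 <= \val z by exact: (set_valP z).
have ap : ray_basic a z e (half (a + \val z * y, y)).
  right; exists (in_half_plane (a + \val z * y, y)) => //.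
  rewrite /= val_half//= y0 ye; split => //.
  have zy : 0 <= sval z * y by exact: mulr_ge0 z0 (ltW y0).
  rewrite addrAC subrr add0r (ger0_norm zy).
  by rewrite mulfK ?gt_eqF// subrr normr0.
have /nbhs_half_rat[//|q /eU Uq] :
    nbhs (half (a + \val z * y, y)) (ray_basic a z e).
  by apply: open_nbhs_nbhs; split => //; exact: open_ray_basic.
by exists q.
Qed.

Lemma separable_moore_sub (A : set R) : separable (moore_sub A).
Proof.
exists (range (fun q : rat * rat => half_in A (ratr q.1, ratr q.2))); split.
  exact: sub_countable (card_image_le _ _) (countableP _).
move=> U [x Ux] [V oV VU].
have Vx : V (set_val x) by rewrite -VU in Ux.
have [q Vq] := nbhs_moore_rat (open_nbhs_nbhs (conj oV Vx)).
exists (half_in A (ratr q.1, ratr q.2)); split; last by exists q.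
by rewrite -VU.
Qed.

End moore.

(* [moore_sub A] is used as a type through the coercion [set_type], which
   carries the subspace topology. *)
Theorem corollary3p1 (R : realType) (A : set R) :
  separable (moore_sub A) /\ contractible R (moore_sub A).
Proof.
by split; [exact: separable_moore_sub|exact: contractible_moore_sub].
Qed.
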